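(* If $G$ and $H$ are graphs where $n(G)\ge 2$, then the corona $G\circ H$ satisfies \[ \mathrm{gp}(G\circ H)=n(G)\,\rho(H). \]
   Context: Graphs are finite, undirected and simple; $n(G)$ is the number of vertices of $G$. If $V(G)=\{v_1,\ldots,v_{n(G)}\}$, the corona $G\circ H$ is obtained from the disjoint union of $G$ and $n(G)$ disjoint copies $H_1,\ldots,H_{n(G)}$ of $H$ by making, for every $i\in\{1,\ldots,n(G)\}$, the vertex $v_i$ adjacent to every vertex of $H_i$. For a graph $G$, $d_G$ is the shortest-path distance (as usual, infinite between vertices of different components). Complete subgraphs $Q$ and $Q'$ of a graph $G$ are independent if $d_G(u,u')\ge 2$ for every $u\in V(Q)$ and every $u'\in V(Q')$. $\rho(G)$ denotes the maximum number of vertices in a union of pairwise independent complete subgraphs of $G$ (a single complete subgraph being allowed). A $u,v$-geodesic is a $u,v$-path of length $d_G(u,v)$. A set $S\subseteq V(G)$ is a general position set of $G$ if no vertex of $S$ lies on a geodesic between two other vertices of $S$. The general position number $\mathrm{gp}(G)$ is the maximum cardinality of a general position set of $G$.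
   Formalization: The formal theorem assumes in addition that G has no isolated vertices and that H has at least one vertex; without these the claim fails, e.g. G = 2K_1, H = K_1 gives gp = 4 but n(G)ρ(H) = 2. *)

(* Defs.v *)
From mathcomp Require Import all_boot.
Set Implicit Arguments.
Unset Strict Implicit.
Unset Printing Implicit Defensive.

Record sgraph := SGraph {
  vertex :> finType;
  adj : rel vertex;
  adj_sym : symmetric adj;
  adj_irrefl : irreflexive adj }.

(* A walk x, p_1, ..., p_k of length k is given by its tail p after x. *)
Definition has_walk (G : sgraph) (x y : G) (k : nat) : bool :=
  [exists p : k.-tuple G, path (@adj G) x p && (last x p == y)].

Lemma connect_has_walk (G : sgraph) (x y : G) :
  connect (@adj G) x y -> exists k, has_walk x y k.
Proof.
case/connectP=> p hp ->; exists (size p).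
by apply/existsP; exists (in_tuple p); rewrite /= hp eqxx.
Qed.

(* None stands for the infinite distance between distinct components. *)
Definition dist (G : sgraph) (x y : G) : option nat :=
  match @idP (connect (@adj G) x y) with
  | ReflectT h => Some (ex_minn (connect_has_walk h))
  | ReflectF _ => None
  end.

Definition dist_ge (k : nat) (d : option nat) : bool :=
  if d is Some m then k <= m else true.

(* A subgraph that is complete is determined by its vertex set. *)
Definition complete_subgraph (G : sgraph) (Q : {set G}) : bool :=
  [forall u in Q, forall v in Q, (u != v) ==> adj u v].

Definition independent (G : sgraph) (Q Q' : {set G}) : bool :=
  [forall u in Q, forall v in Q', dist_ge 2 (dist u v)].

Definition independent_complete_family (G : sgraph) (F : {set {set G}}) : bool :=
  [forall Q in F, complete_subgraph Q] &&
  [forall Q in F, forall Q' in F, (Q != Q') ==> independent Q Q'].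

Definition rho (G : sgraph) : nat :=
  \max_(F : {set {set G}} | independent_complete_family F) #|cover F|.

(* u :: p is a u,v-path with d(u,v) edges. *)
Definition geodesic (G : sgraph) (u v : G) (p : seq G) : bool :=
  [&& path (@adj G) u p, last u p == v, uniq (u :: p)
    & dist u v == Some (size p)].

(* Fixing the length of the tail at d(u,v) loses nothing and makes the
   quantification over geodesics finite. *)
Definition on_geodesic (G : sgraph) (u v w : G) : bool :=
  if dist u v is Some d then
    [exists p : d.-tuple G, geodesic u v p && (w \in u :: p)]
  else false.

Definition general_position (G : sgraph) (S : {set G}) : bool :=
  [forall u in S, forall v in S, forall w in S,
     [&& u != v, w != u & w != v] ==> ~~ on_geodesic u v w].

Definition gp (G : sgraph) : nat :=
  \max_(S : {set G} | general_position S) #|S|.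

(* inl g is a vertex of G; inr (g, h) is the vertex h of the copy of H
   attached to g. *)
Definition corona_adj (G H : sgraph) : rel (G + G * H)%type :=
  fun a b =>
    match a, b with
    | inl g, inl g' => adj g g'
    | inl g, inr (g', _) => g == g'
    | inr (g, _), inl g' => g == g'
    | inr (g, h), inr (g', h') => (g == g') && adj h h'
    end.

Lemma corona_sym (G H : sgraph) : symmetric (@corona_adj G H).
Proof.
move=> [g|[g h]] [g'|[g' h']] //=; first exact: adj_sym.
by rewrite eq_sym adj_sym.
Qed.

Lemma corona_irrefl (G H : sgraph) : irreflexive (@corona_adj G H).
Proof. by move=> [g|[g h]] /=; rewrite adj_irrefl ?andbF. Qed.

Definition corona (G H : sgraph) : sgraph :=
  SGraph (@corona_sym G H) (@corona_irrefl G H).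

(* Main.v *)
Require Import Defs.
From mathcomp Require Import all_boot.
From mathcomp Require Import zify.
Set Implicit Arguments.
Unset Strict Implicit.
Unset Printing Implicit Defensive.

(** A set of vertices of [H] is a union of pairwise independent complete
    subgraphs iff it contains no induced path on three vertices, so [rho H] is
    the largest size of such a set.  A walk entering or leaving the copy [H_g]
    must pass through [g], and two vertices of [H_g] are at distance at most 2.
    Hence a vertex of [H_g] lies strictly inside a geodesic only as the middle
    of an induced path on three vertices of [H_g], which gives the lower bound.
    Conversely, a general position set [S] meets each [H_g] in at most [rho H]
    vertices.  If [S] contains both [g] and a vertex of [H_g], then [S] has no
    vertex outside [H_g + g] in the component of [g]; the excess of one at [g]
    is paid for by a neighbour [x] of [g], as [S] does not meet [H_x + x]. *)

(** * Walks, distances and geodesics *)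

Section Walks.

Variable G : sgraph.
Implicit Types (x y z u v w : G) (k l m : nat).

Lemma has_walkP x y k :
  reflect (exists p, [/\ path (@adj G) x p, last x p = y & size p = k])
    (has_walk x y k).
Proof.
apply: (iffP existsP) => [[p /andP [hp /eqP hl]]|[p [hp hl <-]]].
  by exists p; rewrite size_tuple.
by exists (in_tuple p); rewrite /= hp hl eqxx.
Qed.

Lemma has_walk0 x y : has_walk x y 0 = (x == y).
Proof.
apply/has_walkP/eqP => [[p [_ <- /size0nil ->]]|->] //.
by exists [::].
Qed.

Lemma has_walk1 x y : has_walk x y 1 = adj x y.
Proof.
apply/has_walkP/idP => [[[|a [|b p]] [//= hp <- _]]|h].
  by rewrite andbT in hp.
by exists [:: y]; rewrite /= h.
Qed.

Lemma has_walk_cat y x z k l :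
  has_walk x y k -> has_walk y z l -> has_walk x z (k + l).
Proof.
move=> /has_walkP [p [hp hl <-]] /has_walkP [q [hq hl' <-]].
by apply/has_walkP; exists (p ++ q); rewrite cat_path last_cat hp hl hq size_cat.
Qed.

Lemma has_walk_sym x y k : has_walk x y k = has_walk y x k.
Proof.
have imp (a b : G) : has_walk a b k -> has_walk b a k.
  case/has_walkP=> p [hp <- <-]; apply/has_walkP.
  exists (rev (belast a p)); split; last by rewrite size_rev size_belast.
    by rewrite rev_path; under eq_path do rewrite adj_sym.
  by case: p {hp} => [|c p] //=; rewrite rev_cons last_rcons.
by apply/idP/idP; apply: imp.
Qed.

Lemma has_walk_connect x y k : has_walk x y k -> connect (@adj G) x y.
Proof. by case/has_walkP=> p [hp <- _]; apply/connectP; exists p. Qed.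

Variant dist_spec x y : option nat -> Type :=
  | DistSome d of has_walk x y d & (forall k, has_walk x y k -> d <= k) :
      dist_spec x y (Some d)
  | DistNone of (forall k, ~~ has_walk x y k) : dist_spec x y None.

Lemma distP x y : dist_spec x y (dist x y).
Proof.
rewrite /dist; case: {-}_ / idP => [h|nh].
  by case: ex_minnP => d hd hmin; constructor.
by constructor=> k; apply/negP => /has_walk_connect.
Qed.

Lemma dist_ge2 x y : dist_ge 2 (dist x y) = (x != y) && ~~ adj x y.
Proof.
rewrite -has_walk0 -has_walk1.
case: distP => [d hd hmin|hN] /=; last by rewrite !hN.
apply/idP/idP => [h2|/andP [h0 h1]].
  by apply/andP; split; apply/negP => /hmin; lia.
by case: d hd {hmin} => [|[|d]] // hd; rewrite hd in h0 h1.
Qed.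

(** Two walks meeting at [w] whose total length is minimal concatenate to a path, so geodesics can
    be handled through walk lengths alone. *)
Lemma on_geodesicP u v w :
  reflect (exists k l, [/\ has_walk u w k, has_walk w v l
             & forall m, has_walk u v m -> k + l <= m])
    (on_geodesic u v w).
Proof.
rewrite /on_geodesic; case: distP => [d hd hmin|hN]; last first.
  constructor=> -[k [l [hk hl _]]].
  by move: (has_walk_cat hk hl); apply/negP.
apply: (iffP existsP) => [[p /andP [/and4P [hp /eqP hl _ _] hw]]|].
  have [q [r [pE lE]]] : exists q r, p = q ++ r :> seq G /\ last u q = w.
    by case/splitPl: hw => q r lE; exists q, r.
  move: hp hl; rewrite pE cat_path last_cat lE => /andP [hq hr] hl.
  exists (size q), (size r); split.
  - by apply/has_walkP; exists q.
  - by apply/has_walkP; exists r.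
  - by move=> m /hmin; rewrite -size_cat -pE size_tuple.
case=> k [l [/has_walkP [q [hq lq sq]] /has_walkP [r [hr lr sr]] kl_min]].
have size_qr : size (q ++ r) == d.
  rewrite size_cat sq sr eqn_leq kl_min //=; apply/hmin/has_walkP.
  by exists (q ++ r); rewrite cat_path last_cat lq hq hr size_cat sq sr.
exists (Tuple size_qr) => /=; apply/andP; split; last first.
  by rewrite -cat_cons mem_cat -lq mem_last.
have hp : path (@adj G) u (q ++ r) by rewrite cat_path hq lq.
have hl : last u (q ++ r) = v by rewrite last_cat lq.
apply/and4P; split=> //; first exact/eqP.
(* A duplicate-free shortening [p'] still has at least [d] edges and uses only vertices of [q ++ r],
   so that list had no repetition. *)
- case: (shortenP hp) hl => p' hp' up' sub hl'.
  apply: (leq_size_uniq up') => [z|]; rewrite ?inE.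
    by case/predU1P => [->|/sub ->]; rewrite ?eqxx ?orbT.
  by rewrite /= ltnS (eqP size_qr); apply/hmin/has_walkP; exists p'.
- case: distP => [e he emin|hN]; last by rewrite (negPf (hN d)) in hd.
  by rewrite (eqP size_qr) eqE /= eqn_leq hmin ?emin.
Qed.

Lemma general_positionP (S : {set G}) :
  reflect (forall u v w, u \in S -> v \in S -> w \in S ->
             u != v -> w != u -> w != v -> ~~ on_geodesic u v w)
    (general_position S).
Proof.
apply: (iffP forall_inP) => [h u v w uS vS wS uv wu wv|h u uS].
  have /forall_inP/(_ v vS)/forall_inP/(_ w wS)/implyP := h u uS.
  by apply; rewrite uv wu wv.
apply/forall_inP => v vS; apply/forall_inP => w wS.
by apply/implyP => /and3P []; apply: h.
Qed.

End Walks.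

(** * Unions of independent cliques *)

Section CliqueUnions.

Variable H : sgraph.
Implicit Types (u v w : H) (T : {set H}) (F : {set {set H}}).

Definition induced_P3_free T : Prop := forall u w v,
  u \in T -> w \in T -> v \in T -> u != v -> adj u w -> adj w v -> adj u v.

(** Adjacent vertices of the cover lie in the same clique, since distinct members are at distance at
    least 2; hence [u], [w], [v] share one clique. *)
Lemma cover_induced_P3_free F :
  independent_complete_family F -> induced_P3_free (cover F).
Proof.
move=> /andP [/forall_inP compl /forall_inP indep].
have same A B u v : A \in F -> B \in F -> u \in A -> v \in B -> adj u v -> A = B.
  move=> AF BF uA vB uv; apply/eqP/negPn/negP => AB.
  have /implyP/(_ AB)/forall_inP/(_ u uA)/forall_inP/(_ v vB) :=
    forall_inP (indep A AF) B BF.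
  by rewrite dist_ge2 uv andbF.
move=> u w v /bigcupP [A AF uA] /bigcupP [B BF wB] /bigcupP [C CF vC] uv uw wv.
have AB := same _ _ _ _ AF BF uA wB uw; have BC := same _ _ _ _ BF CF wB vC wv.
rewrite -BC -AB in vC.
exact: (implyP (forall_inP (forall_inP (compl A AF) u uA) v vC)).
Qed.

(** Being equal or adjacent is an equivalence relation on [T]; its classes are pairwise independent
    cliques covering [T]. *)
Lemma induced_P3_free_leq_rho T : induced_P3_free T -> #|T| <= rho H.
Proof.
move=> free; pose R u v := (u == v) || adj u v.
have R_equiv : {in T & &, equivalence_rel R}.
  have Rsym u v : R u v = R v u by rewrite /R eq_sym adj_sym.
  have Rtrans u v w : u \in T -> v \in T -> w \in T -> R u v -> R v w -> R u w.
    move=> uT vT wT /predU1P [-> //|uv] /predU1P [<-|vw]; first by rewrite /R uv orbT.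
    by rewrite /R; case: eqVneq => //= uw; apply: (free u v w).
  move=> u v w uT vT wT; split; first by rewrite /R eqxx.
  move=> uv; apply/idP/idP; last exact: Rtrans.
  by apply: Rtrans => //; rewrite Rsym.
have part := equivalence_partitionP R_equiv.
rewrite -(cover_partition part); apply: leq_bigmax_cond.
have triv : trivIset (equivalence_partition R T) by case/and3P: part.
apply/andP; split; apply/forall_inP => _ /imsetP [a aT ->].
  apply/forall_inP => u; rewrite inE => /andP [uT au].
  apply/forall_inP => v; rewrite inE => /andP [vT av]; apply/implyP => uv.
  have : R u v by rewrite -(R_equiv a u v aT uT vT).2.
  by rewrite /R (negPf uv).
apply/forall_inP => _ /imsetP [b bT ->]; apply/implyP => neq.
apply/forall_inP => u; rewrite inE => /andP [uT au].
apply/forall_inP => v; rewrite inE => /andP [vT bv].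
rewrite dist_ge2 -negb_or; apply: contra neq => uv; apply/eqP/setP => x.
rewrite !inE; case xT: (x \in T) => //=.
rewrite (R_equiv a u x _ _ _).2 // (R_equiv u v x _ _ _).2 //.
by rewrite -(R_equiv b v x _ _ _).2.
Qed.

Lemma rho_witness : exists2 T, induced_P3_free T & #|T| = rho H.
Proof.
(* Some family exists, so the maximum defining [rho] is attained. *)
have fam0 : independent_complete_family (set0 : {set {set H}}).
  by apply/andP; split; apply/forall_inP => Q; rewrite inE.
have [|F famF rhoE] :=
  @eq_bigmax_cond _ (@independent_complete_family H) (fun F => #|cover F|).
  by apply/card_gt0P; exists set0.
by exists (cover F); [apply: cover_induced_P3_free | rewrite /rho rhoE].
Qed.

Lemma rho_gt0 : 0 < #|H| -> 0 < rho H.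
Proof.
case/card_gt0P => h _; rewrite -(cards1 h); apply: induced_P3_free_leq_rho.
by move=> u w v /set1P -> _ /set1P ->; rewrite eqxx.
Qed.

End CliqueUnions.

(** * Geodesics in the corona *)

Section Corona.

Variables G H : sgraph.
Local Notation C := (corona G H).
Implicit Types (g x : G) (h : H).

Definition root g : C := inl g.
Definition leaf g h : C := inr (g, h).
Definition base (c : C) : G :=
  match c with inl g => g | inr (g, _) => g end.

Lemma adj_root_leaf g h : adj (root g) (leaf g h).
Proof. exact: eqxx. Qed.

Lemma adj_leaf g h h' : adj (leaf g h) (leaf g h') = adj h h'.
Proof. by rewrite /= eqxx. Qed.

Lemma leaf_eq g h h' : (leaf g h == leaf g h') = (h == h').
Proof. by apply/eqP/eqP => [[]|->]. Qed.

Lemma leaf_walk2 g h h' : has_walk (leaf g h) (leaf g h') 2.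
Proof.
apply: (@has_walk_cat _ (root g) _ _ 1 1); rewrite has_walk1 ?adj_root_leaf //.
by rewrite adj_sym adj_root_leaf.
Qed.

Lemma connect_base (c : C) : connect (@adj C) c (root (base c)).
Proof.
case: c => [g|[g h]] //=; apply: connect1.
exact: eqxx.
Qed.

(** The only vertex outside the copy at [g] with neighbours in it is [root g]; the part of the walk
    up to that vertex is strictly shorter. *)
Lemma walk_into_leaf (u : C) g h k :
  (forall h', u != leaf g h') -> has_walk u (leaf g h) k ->
  exists2 l, has_walk u (root g) l & l < k.
Proof.
move=> notin /has_walkP [p [hp hl <-]] {k}.
elim: p u notin hp hl => [|a p IHp] u notin /=.
  by move=> _ /eqP; rewrite (negPf (notin h)).
case/andP=> ua hp hl; have [->|u_root] := eqVneq u (root g).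
  by exists 0; rewrite ?has_walk0.
have [h'|l hal lp] := IHp a _ hp hl.
  apply/eqP => aE; move: ua u_root (notin); rewrite aE {aE}.
  case: u notin => [x|[x y]] _ /=; first by move=> /eqP ->; rewrite eqxx.
  by case/andP => /eqP -> _ _ /(_ y); rewrite eqxx.
by exists l.+1; rewrite // -add1n; apply: has_walk_cat hal; rewrite has_walk1.
Qed.

(** If an end is outside the copy, replacing [leaf g h] by [root g] shortens the walk: an outer end
    is strictly nearer to the root, an inner one is at distance 1 from it. With both ends inside,
    the distance is at most 2, which forces [k = l = 1]. *)
Lemma leaf_inside_geodesic (u v : C) g h :
  u != leaf g h -> v != leaf g h -> on_geodesic u v (leaf g h) ->
  exists hu hv, [/\ u = leaf g hu, v = leaf g hv, adj hu h, adj h hv & ~~ adj hu hv].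
Proof.
have leafP (c : C) : (exists h', c = leaf g h') \/ (forall h', c != leaf g h').
  case: c => [x|[x h']]; first by right.
  have [->|xg] := eqVneq x g; first by left; exists h'.
  by right=> h''; apply: contra xg => /eqP [->].
have to_root h' : has_walk (leaf g h') (root g) 1.
  by rewrite has_walk1 adj_sym adj_root_leaf.
have pos (a b : C) k : a != b -> has_walk a b k -> 0 < k.
  by move=> ab; case: k => //; rewrite has_walk0 (negPf ab).
move=> uw vw /on_geodesicP [k [l [hk hl kl_min]]].
have k0 := pos _ _ _ uw hk; have l0 : 0 < l by apply: pos hl; rewrite eq_sym.
have hl' : has_walk v (leaf g h) l by rewrite has_walk_sym.
case: (leafP u) => [[hu uE]|u_out]; case: (leafP v) => [[hv vE]|v_out].
- have kl2 : k + l <= 2 by apply: kl_min; rewrite uE vE leaf_walk2.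
  have k1 : k = 1 by lia.
  have l1 : l = 1 by lia.
  exists hu, hv; split=> //; rewrite -(adj_leaf g) -has_walk1.
  + by rewrite -uE -k1.
  + by rewrite -vE -l1.
  + by rewrite -uE -vE; apply/negP => /kl_min; lia.
- have [m hm ml] := walk_into_leaf v_out hl'.
  have : k + l <= 1 + m by apply/kl_min/has_walk_cat; rewrite ?uE // has_walk_sym.
  lia.
- have [m hm mk] := walk_into_leaf u_out hk.
  have : k + l <= m + 1 by apply: kl_min; apply: has_walk_cat hm _; rewrite vE has_walk_sym.
  lia.
- have [m hm mk] := walk_into_leaf u_out hk.
  have [n hn nl] := walk_into_leaf v_out hl'.
  have : k + l <= m + n by apply: kl_min; apply: has_walk_cat hm _; rewrite has_walk_sym.
  lia.
Qed.

Lemma leaf_on_geodesic g hu h hv :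
  hu != hv -> adj hu h -> adj h hv -> ~~ adj hu hv ->
  on_geodesic (leaf g hu) (leaf g hv) (leaf g h).
Proof.
move=> neq uh hv_adj nadj; apply/on_geodesicP; exists 1, 1.
rewrite !has_walk1 !adj_leaf; split=> // -[|[|m]] //.
  by rewrite has_walk0 leaf_eq (negPf neq).
by rewrite has_walk1 adj_leaf (negPf nadj).
Qed.

(** Any walk from [v] to the leaf passes through [root g], so a shortest walk to the root followed
    by one edge is shortest. *)
Lemma root_on_geodesic g h (v : C) :
  base v != g -> connect (@adj C) v (root g) -> on_geodesic v (leaf g h) (root g).
Proof.
move=> vg /connect_has_walk ex.
have [m hm mmin] := ex_minnP ex.
apply/on_geodesicP; exists m, 1; rewrite has_walk1 adj_root_leaf; split=> // k hk.
have v_out h' : v != leaf g h' by apply: contra vg => /eqP ->.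
have [l /mmin ml lk] := walk_into_leaf v_out hk.
lia.
Qed.

(** * The two bounds on the general position number *)

Lemma gp_corona_lower_bound : #|G| * rho H <= gp (corona G H).
Proof.
have [T free <-] := rho_witness H.
pose emb (q : G * H) : C := inr q.
have emb_inj : injective emb by move=> a b [].
rewrite -cardsT -cardsX -(card_imset _ emb_inj); apply: leq_bigmax_cond.
have in_T g h : (leaf g h \in emb @: setX setT T) = (h \in T).
  by rewrite (mem_imset _ _ emb_inj) in_setX inE.
apply/general_positionP => u v w uS vS /imsetP [[g h] /setXP [_ /= hT] ->].
rewrite -/(leaf g h) => uv wu wv.
apply/negP => /leaf_inside_geodesic [||hu [hv [uE vE uh hhv /negP]]]; rewrite 1?eq_sym //.
rewrite uE vE leaf_eq in uv; rewrite uE in_T in uS; rewrite vE in_T in vS.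
by apply; apply: (free _ h).
Qed.

Lemma gp_corona_upper_bound :
  (forall x : G, exists y : G, adj x y) -> 0 < #|H| -> gp (corona G H) <= #|G| * rho H.
Proof.
move=> no_isolated H0; apply/bigmax_leqP => S /general_positionP gpS.
have rho0 := rho_gt0 H0.
pose f g := xchoose (no_isolated g).
have f_adj g : adj g (f g) := xchooseP (no_isolated g).
pose T g := [set h | leaf g h \in S].
(* Only over these vertices can a fiber exceed [rho H], and then by one; the neighbour [f g]
   compensates. *)
pose bad := [set g | (root g \in S) && (T g != set0)].
pose fiber g := [set c in S | base c == g].
have T_rho g : #|T g| <= rho H.
  apply: induced_P3_free_leq_rho => u w v; rewrite !inE => uS wS vS uv uw wv.
  apply/negPn/negP => nuv; have := leaf_on_geodesic g uv uw wv nuv.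
  apply/negP/gpS => //; rewrite leaf_eq //; apply/eqP => E; subst.
    by rewrite adj_irrefl in uw.
  by rewrite adj_irrefl in wv.
have fiberE g : #|fiber g| = (root g \in S) + #|T g|.
  have leaf_inj : injective (leaf g) by move=> a b [].
  rewrite (cardsD1 (root g)) !inE eqxx andbT; congr addn.
  rewrite -(card_imset _ leaf_inj); congr #|pred_of_set _|; apply/setP => c.
  rewrite !inE; apply/idP/imsetP => [|[h]]; last by rewrite inE => hS ->; rewrite hS /=.
  case: c => [x|[x h]] /and3P [cg cS /eqP xg]; rewrite /= in xg; subst x.
    by rewrite eqxx in cg.
  by exists h; rewrite ?inE.
(* Otherwise [root g] would lie on a geodesic from [v] to a leaf over [g], all three in [S]. *)
have bad_alone g v : g \in bad -> v \in S -> connect (@adj C) v (root g) -> base v = g.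
  rewrite inE => /andP [gS /set0Pn [h]]; rewrite inE => hS vS conn.
  apply/eqP/negPn/negP => vg; have := root_on_geodesic h vg conn.
  by apply/negP/gpS => //; apply: contra vg => /eqP; [move=> ->| move=> <-].
have conn_f g : connect (@adj C) (root (f g)) (root g).
  by apply: connect1; rewrite adj_sym; apply: f_adj.
have C_sym := sym_connect_sym (@adj_sym C).
(* A common neighbour puts [root a] and [root b] in one component, so [bad_alone] gives [a = b]. *)
have f_inj : {in bad &, injective f}.
  move=> a b a_bad b_bad fab.
  apply: (bad_alone b (root a)) => //; first by move: a_bad; rewrite inE => /andP [].
  by apply: connect_trans (conn_f b); rewrite -fab C_sym.
have fiber_bound g : #|fiber g| + (g \in f @: bad) <= rho H + (g \in bad).
  have [/imsetP [b b_bad gE]|_] := boolP (g \in f @: bad).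
    (* A vertex of [S] over [f b] would lie in the component of [b], hence over [b] itself, making
       [b] adjacent to itself. *)
    suff -> : fiber g = set0 by rewrite cards0; lia.
    apply/setP => v; rewrite !inE; apply/negP => /andP [vS /eqP vg].
    have vb : base v = b.
      apply: bad_alone => //; apply: connect_trans (conn_f b).
      by rewrite -gE -vg connect_base.
    by have := f_adj b; rewrite -gE -vg vb adj_irrefl.
  rewrite fiberE inE; have := T_rho g.
  case: (root g \in S) => /=; last by lia.
  (* When the root is the whole fiber, its single vertex is covered by [rho0]. *)
  by case: eqVneq => [->|_] /=; rewrite ?cards0; lia.
have card_S : #|S| = \sum_g #|fiber g|.
  rewrite -sum1_card (partition_big base predT) //=.
  by apply: eq_bigr => g _; rewrite -sum1_card; apply: eq_bigl => c; rewrite !inE.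
(* The two correction terms sum to [#|f @: bad|] and [#|bad|], which agree by [f_inj] and cancel. *)
have : \sum_g (#|fiber g| + (g \in f @: bad)) <= \sum_g (rho H + (g \in bad)).
  by apply: leq_sum => g _; apply: fiber_bound.
have cardE (A : {set G}) : \sum_g (g \in A : nat) = #|A|.
  by rewrite -sum1_card [RHS]big_mkcond.
rewrite !big_split /= !cardE card_in_imset // sum_nat_const -card_S.
by rewrite leq_add2r.
Qed.

End Corona.

(** Isolated vertices and an empty [H] give counterexamples: for two isolated vertices and a
    one-vertex [H] the corona is two disjoint edges, with [gp] equal to 4 and not 2; for empty [H]
    the corona is [G] and the product is 0. *)
Theorem theorem4p3 (G H : sgraph)
    (G_order : 2 <= #|G|)
    (G_no_isolated : forall x : G, exists y : G, adj x y)
    (H_nonempty : 0 < #|H|) :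
  gp (corona G H) = #|G| * rho H.
Proof.
apply/eqP; rewrite eqn_leq gp_corona_upper_bound //.
exact: gp_corona_lower_bound.
Qed.
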